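(* Let $F(x)=\frac12x^TAx+b^Tx$ with $A\in\mathbb R^{n\times n}$ symmetric, zero diagonal, $A\ge0$, $b\ge0$. Let $\mathcal M$ be a matroid on $[n]$ with rank $r$ and minimum circuit size $c\ge3$, with matroid polytope $P_{\mathcal M}$. If $x^*\in P_{\mathcal M}$, then $x^*$ has a quadratic coverage of size at most $3+\frac{2r}{c-2}$.
   Context: For $x^*\in P_{\mathcal M}$ (the convex hull of characteristic vectors of independent sets) and distinct $u,v\in[n]$, let $Cov(u,v)=x^*(u)x^*(v)$. For a set $X$, $cov(X)=\{\{u,v\}:u,v\in X,u\ne v\}$. A quadratic coverage of $x^*$ is a finite collection $\{(I_i,\mu_i)\}$ of independent sets $I_i$ of $\mathcal M$ with weights $\mu_i\ge0$ such that (1) for all distinct $u,v$, $\sum_{i:\{u,v\}\in cov(I_i)}\mu_i\ge Cov(u,v)$, and (2) for all $v$, $\sum_{i:v\in I_i}\mu_i\ge x^*(v)$. Its size is $\sum_i\mu_i$. *)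

(* Defs.v *)
From mathcomp Require Import all_boot all_order all_algebra.
From mathcomp Require Import reals.

Set Implicit Arguments.
Unset Strict Implicit.
Unset Printing Implicit Defensive.

Import Order.TTheory GRing.Theory Num.Theory.
Local Open Scope ring_scope.

Record matroid (T : finType) := Matroid {
  indep : {set {set T}};
  indep0 : set0 \in indep;
  indep_sub : forall I J : {set T}, J \in indep -> I \subset J -> I \in indep;
  indep_aug : forall I J : {set T}, I \in indep -> J \in indep ->
    (#|I| < #|J|)%N -> exists2 e, e \in J :\: I & e |: I \in indep
}.

Definition matroid_rank (T : finType) (M : matroid T) : nat :=
  \max_(I in indep M) #|I|.

Definition circuit (T : finType) (M : matroid T) (C : {set T}) : bool :=
  minset (fun D : {set T} => D \notin indep M) C.

(* A free matroid has no circuit, so its minimum circuit size is conventionally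
   infinite; here it is allowed with every value of c. *)
Definition min_circuit_size (T : finType) (M : matroid T) (c : nat) : Prop :=
  (forall C, circuit M C -> (c <= #|C|)%N) /\
  ((exists C, circuit M C) -> exists2 C, circuit M C & #|C| = c).

Definition char_vec (R : realType) (n : nat) (I : {set 'I_n}) : 'cV[R]_n :=
  \col_i (i \in I)%:R.

Definition in_matroid_polytope (R : realType) (n : nat) (M : matroid 'I_n)
    (x : 'cV[R]_n) : Prop :=
  exists l : {set 'I_n} -> R,
    [/\ forall I, I \in indep M -> 0 <= l I,
        \sum_(I in indep M) l I = 1 &
        x = \sum_(I in indep M) l I *: char_vec R I].

Definition Cov (R : realType) (n : nat) (x : 'cV[R]_n) (u v : 'I_n) : R :=
  x u 0 * x v 0.

Definition cov (T : finType) (X : {set T}) : {set {set T}} :=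
  [set [set u; v] | u in X, v in X & u != v].

(* A finite collection is a list of pairs (I_i, mu_i), so that the same
   independent set may occur several times. *)
Definition quadratic_coverage (R : realType) (n : nat) (M : matroid 'I_n)
    (x : 'cV[R]_n) (Q : seq ({set 'I_n} * R)) : Prop :=
  [/\ forall p, p \in Q -> p.1 \in indep M /\ 0 <= p.2,
      forall u v : 'I_n, u != v ->
        Cov x u v <= \sum_(p <- Q | [set u; v] \in cov p.1) p.2 &
      forall v : 'I_n, x v 0 <= \sum_(p <- Q | v \in p.1) p.2].

Definition coverage_size (R : realType) (n : nat)
    (Q : seq ({set 'I_n} * R)) : R :=
  \sum_(p <- Q) p.2.

(* Main.v *)
(* Write x* as a convex combination of independent sets I with weights l_I, and
   treat every pair (I, J) separately with weight l_I l_J. Cut I into pieces S of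
   size at most s = floor((c - 1) / 2). Extending S by elements of J gives an
   independent K containing S with |J \ K| <= |S|, and S together with J \ K is
   independent because it has fewer than c elements; these two sets cover all
   pairs in S x J. Taking them with weight 1/2 and I with weight 1 gives total
   size at most 2 + r / s, and s >= (c - 2) / 2. *)
Require Import Defs.
From mathcomp Require Import all_boot all_order all_algebra.
From mathcomp Require Import boolp reals.
From mathcomp Require Import zify ring lra.
Import Order.TTheory GRing.Theory Num.Theory.
Local Open Scope ring_scope.

Set Implicit Arguments.
Unset Strict Implicit.
Unset Printing Implicit Defensive.

(** A dependent set contains a minimal dependent set, which is a circuit and so has at least [c]
    elements. *)
Lemma indep_lt_circuit (T : finType) (M : matroid T) (c : nat) (X : {set T}) :
  (forall C, circuit M C -> (c <= #|C|)%N) -> (#|X| < c)%N -> X \in indep M.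
Proof.
move=> cmin Xc; apply: contraLR (Xc) => XD; rewrite -leqNgt.
have [C Cmin CX] := @minset_exists _ (fun D => D \notin indep M) X XD.
exact: leq_trans (cmin C Cmin) (subset_leq_card CX).
Qed.

(** Augment from [J] until its size is reached, by induction on a bound [k] for the truncated
    difference; at zero [S] itself is large enough. *)
Lemma indep_extend (T : finType) (M : matroid T) (S J : {set T}) :
  S \in indep M -> J \in indep M ->
  exists K, [/\ K \in indep M, S \subset K, K \subset S :|: J & (#|J| <= #|K|)%N].
Proof.
move: {-1}(#|J| - #|S|)%N (leqnn (#|J| - #|S|)) => k.
elim: k S => [|k IH] S hk SI JI.
  by exists S; split; rewrite ?subsetUl //; lia.
have [leJS|ltSJ] := leqP #|J| #|S|; first by exists S; rewrite subsetUl.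
have [e /setDP[eJ eS] eSI] := indep_aug SI JI ltSJ.
have [|K [KI eSK KeSJ leJK]] := IH _ _ eSI JI; first by rewrite cardsU1 eS; lia.
exists K; split=> //; first exact: subset_trans (subsetUr _ _) eSK.
by apply: subset_trans KeSJ _; rewrite -setUA subUset subxx sub1set inE eJ orbT.
Qed.

(** Peel off up to [s] elements, [m] times. Late pieces may be empty, so the number of pieces is
    exactly [m]. *)
Lemma cover_by_small_sets (T : finType) (s m : nat) (X : {set T}) :
  (#|X| <= m * s)%N ->
  exists P : seq {set T}, [/\ size P = m,
    {in P, forall S : {set T}, S \subset X /\ (#|S| <= s)%N} &
    forall u, u \in X -> exists2 S : {set T}, S \in P & u \in S].
Proof.
elim: m X => [|m IH] X hX.
  exists [::]; split=> // u uX; move: hX; rewrite mul0n leqn0 cards_eq0.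
  by move=> /eqP X0; rewrite X0 inE in uX.
pose S := [set x in take s (enum X)].
have SX : S \subset X.
  by apply/subsetP=> x; rewrite inE => /mem_take; rewrite mem_enum.
have cS : #|S| = minn s #|X|.
  rewrite cardsE (card_uniqP _) ?take_uniq ?enum_uniq // size_take -cardE.
  by rewrite /minn.
have [|P [sP PX PX']] := IH (X :\: S).
  by rewrite cardsD (setIidPr SX) cS; lia.
exists (S :: P); split=> /= [|S'|u uX]; first by rewrite sP.
  rewrite inE => /predU1P[->|/PX[S'X S's]]; first by rewrite cS geq_minl.
  by split=> //; apply: subset_trans S'X (subsetDl _ _).
have [uS|uS] := boolP (u \in S); first by exists S; rewrite ?mem_head.
have [|S' S'P uS'] := PX' u; first by rewrite inE uS.
by exists S' => //; rewrite inE S'P orbT.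
Qed.

Lemma indep_small_cross_cover (T : finType) (M : matroid T) (c : nat)
    (S J : {set T}) :
  (forall C, circuit M C -> (c <= #|C|)%N) -> (#|S|.*2 < c)%N ->
  J \in indep M ->
  exists K K' : {set T}, [/\ K \in indep M, K' \in indep M &
    forall u v, u \in S -> v \in J ->
      [&& u \in K & v \in K] || [&& u \in K' & v \in K']].
Proof.
move=> cmin Sc JI; have SI : S \in indep M.
  by apply: (indep_lt_circuit cmin); lia.
have [K [KI SK KSJ leJK]] := indep_extend SI JI.
(* Since [K] lies in the union of [S] and [J :&: K], the bound [#|J| <= #|K|] leaves at most [#|S|]
   elements of [J] outside [K]. *)
have leT : (#|J :\: K| <= #|S|)%N.
  have leK : (#|K| <= #|S| + #|J :&: K|)%N.
    apply: leq_trans (leq_card_setU S (J :&: K)); apply: subset_leq_card.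
    apply/subsetP=> x xK; have /setUP[xS|xJ] := subsetP KSJ x xK.
      by rewrite inE xS.
    by rewrite !inE xJ xK orbT.
  by have := cardsID K J; lia.
exists K, (S :|: (J :\: K)); split=> //.
  apply: (indep_lt_circuit cmin).
  by apply: leq_ltn_trans (leq_card_setU _ _) _; lia.
move=> u v uS vJ; rewrite !inE uS vJ (subsetP SK) //= andbT.
by case: (v \in K); rewrite ?orbT.
Qed.

Lemma indep_cross_cover (T : finType) (M : matroid T) (c s m : nat)
    (I J : {set T}) :
  (forall C, circuit M C -> (c <= #|C|)%N) -> (s.*2 < c)%N ->
  J \in indep M -> (#|I| <= m * s)%N ->
  exists L : seq {set T}, [/\ size L = m.*2, {subset L <= indep M} &
    forall u v, u \in I -> v \in J ->
      has (fun K : {set T} => [&& u \in K & v \in K]) L].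
Proof.
move=> cmin sc JI /cover_by_small_sets[P [<- Psmall Pcover]].
(* The goal is restated piece by piece, because the tail of [P] no longer covers [I] in the
   induction. Each piece contributes two sets. *)
suff [L [sL LI LP]] : exists L : seq {set T},
    [/\ size L = (size P).*2, {subset L <= indep M} &
    forall S u v, S \in P -> u \in S -> v \in J ->
      has (fun K : {set T} => [&& u \in K & v \in K]) L].
  by exists L; split=> // u v /Pcover[S SP uS]; apply: LP uS.
have {Psmall} : {in P, forall S : {set T}, (#|S| <= s)%N} by move=> S /Psmall[].
elim: P {Pcover} => [|S P IH] Ps; first by exists [::].
have [S' S'P|L [sL LI LP]] := IH; first by apply: Ps; rewrite inE S'P orbT.
have [||K [K' [KI K'I KK']]] := @indep_small_cross_cover _ M c S J cmin => //.
  by have := Ps S (mem_head _ _); lia.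
exists [:: K, K' & L]; split=> /= [|K0|S' u v]; first by rewrite sL doubleS.
  by rewrite !inE => /or3P[/eqP->|/eqP->|/LI].
rewrite inE orbA => /predU1P[->|S'P] uS vJ; first by rewrite KK'.
by rewrite (LP S') ?orbT.
Qed.

Lemma mem_cov_pair (T : finType) (X : {set T}) (u v : T) :
  u != v -> u \in X -> v \in X -> [set u; v] \in cov X.
Proof. by move=> uv uX vX; apply/imset2P; exists u v; rewrite ?inE ?vX. Qed.

(* The demand of the pair [(I, J)] on [{u, v}] is symmetrised, which is what
   allows the sets covering [I] times [J] to have weight [1/2] only. *)
Lemma pair_coverage (R : realType) (n : nat) (M : matroid 'I_n)
    (c s m : nat) (I J : {set 'I_n}) :
  (forall C, circuit M C -> (c <= #|C|)%N) -> (s.*2 < c)%N ->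
  I \in indep M -> J \in indep M -> (#|I| <= m * s)%N ->
  exists G : seq ({set 'I_n} * R), [/\
    forall p, p \in G -> p.1 \in indep M /\ 0 <= p.2,
    forall u v, u != v ->
      2^-1 * ((u \in I)%:R * (v \in J)%:R + (v \in I)%:R * (u \in J)%:R)
        <= \sum_(p <- G | [set u; v] \in cov p.1) p.2,
    forall v, (v \in I)%:R <= \sum_(p <- G | v \in p.1) p.2 &
    coverage_size G = 1 + m%:R].
Proof.
move=> cmin sc II JI Im.
have [L [sL LI LP]] := indep_cross_cover cmin sc JI Im.
(* The set [I] at weight 1 serves the single elements and the pairs inside [I]; the [m.*2] sets of
   [L] add [m] to the size. *)
exists ((I, 1) :: [seq (K, 2^-1) | K <- L]).
have h0 : 0 <= 2^-1 :> R by rewrite invr_ge0.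
split=> [p|u v uv|v|].
- rewrite inE => /predU1P[->|/mapP[K KL ->]] /=; first by rewrite II.
  by split=> //; apply: LI.
- rewrite big_cons big_map /=.
  pose t : R := \sum_(K <- L | [set u; v] \in cov K) 2^-1.
  have t0 : 0 <= t by apply: sumr_ge0.
  have half (x y : 'I_n) : [set x; y] = [set u; v] -> x != y ->
      x \in I -> y \in J -> 2^-1 <= t.
    move=> e xy xI yJ; have /hasP[K KL /andP[xK yK]] := LP x y xI yJ.
    rewrite /t (big_rem K) //= -e mem_cov_pair // lerDl.
    exact: sumr_ge0.
  have huv := half u v erefl uv.
  have hvu := half v u (setUC _ _); rewrite eq_sym in hvu.
  have {hvu} hvu := hvu uv.
  rewrite -/t; have := @mem_cov_pair _ I u v uv.
  move: huv hvu.
  (* If [u] and [v] both lie in [I], then [I] alone supplies 1. Otherwise at most one product is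
     nonzero, and [t] meets the demand of at most 1/2. *)
  case: (u \in I); case: (v \in I); case: (u \in J); case: (v \in J) => /=;
    move=> h1 h2 h3; try rewrite (h3 isT isT);
    try (have {}h1 := h1 isT isT); try (have {}h2 := h2 isT isT);
    try case: ifP => _; rewrite ?mulr1n ?mulr0n;
    clearbody t; clear -t0 h0 h1 h2; lra.
- rewrite big_cons big_map /=.
  have t0 : 0 <= \sum_(K <- L | v \in K) 2^-1 :> R by apply: sumr_ge0.
  by case: (v \in I); rewrite ?lerDl.
rewrite /coverage_size big_cons big_map /= big_const_seq count_predT sL.
by rewrite iter_addr_0 -[_ *+ _]mulr_natr -muln2 natrM; field.
Qed.

(* If [X] and [Y] are independent samples of the distribution [l] then
   [x u * x v] is the probability of [u \in X] and [v \in Y]. *)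
Lemma Cov_convex_combination (R : realType) (n : nat) (A : {set {set 'I_n}})
    (l : {set 'I_n} -> R) (u v : 'I_n) :
  Cov (\sum_(I in A) l I *: char_vec R I) u v =
    \sum_(p in setX A A) l p.1 * l p.2 *
      (2^-1 * ((u \in p.1)%:R * (v \in p.2)%:R + (v \in p.1)%:R * (u \in p.2)%:R)).
Proof.
have entry w : (\sum_(I in A) l I *: char_vec R I) w 0 =
    \sum_(I in A) l I * (w \in I)%:R.
  by rewrite summxE; apply: eq_bigr => I _; rewrite !mxE.
have prod a b : Cov (\sum_(I in A) l I *: char_vec R I) a b =
    \sum_(p in setX A A) l p.1 * l p.2 * ((a \in p.1)%:R * (b \in p.2)%:R).
  rewrite /Cov !entry big_distrlr /= pair_big /=.
  apply: eq_big => [[I J]|[I J] _] /=; first by rewrite inE.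
  by rewrite mulrACA.
have -> : Cov (\sum_(I in A) l I *: char_vec R I) u v =
    2^-1 * (Cov (\sum_(I in A) l I *: char_vec R I) u v +
            Cov (\sum_(I in A) l I *: char_vec R I) v u).
  by rewrite /Cov; field.
rewrite !prod -big_split /= mulr_sumr; apply: eq_bigr => p _.
by rewrite -mulrDr mulrCA.
Qed.

Theorem theorem6 (R : realType) (n : nat)
  (A : 'M[R]_n) (b : 'cV[R]_n) (F : 'cV[R]_n -> R)
  (hF : forall x : 'cV[R]_n,
     F x = 2^-1 * (x^T *m A *m x) 0 0 + (b^T *m x) 0 0)
  (A_sym : A^T = A)
  (A_diag : forall i : 'I_n, A i i = 0)
  (A_ge0 : forall i j : 'I_n, 0 <= A i j)
  (b_ge0 : forall i : 'I_n, 0 <= b i 0)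
  (M : matroid 'I_n) (r c : nat)
  (hr : matroid_rank M = r)
  (hc : min_circuit_size M c)
  (c_ge3 : (3 <= c)%N)
  (xstar : 'cV[R]_n)
  (hx : in_matroid_polytope M xstar) :
  exists Q : seq ({set 'I_n} * R),
    quadratic_coverage M xstar Q /\
    coverage_size Q <= 3 + 2 * r%:R / (c%:R - 2).
Proof.
have [l [l_ge0 l_sum ->]] := hx; have [cmin _] := hc.
(* [s] is the largest integer with [s.*2 < c], positive as [c >= 3]; [m] pieces of size [s] suffice
   for any independent set. *)
pose s := c.-1./2; pose m := (r %/ s).+1.
have s_gt0 : (0 < s)%N by rewrite /s; lia.
have s_lt : (s.*2 < c)%N by rewrite /s; lia.
have c_le : (c <= s.*2 + 2)%N by rewrite /s; lia.
have card_le I : I \in indep M -> (#|I| <= m * s)%N.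
  move=> II; apply: (@leq_trans r); last exact/ltnW/ltn_ceil.
  by rewrite -hr /matroid_rank; apply: (@leq_bigmax_cond _ _ (fun I : {set 'I_n} => #|I|)).
have /choice[G Gspec] (p : {set 'I_n} * {set 'I_n}) : exists G,
    p \in setX (indep M) (indep M) -> [/\
    forall q, q \in G -> q.1 \in indep M /\ 0 <= q.2,
    forall u v, u != v ->
      2^-1 * ((u \in p.1)%:R * (v \in p.2)%:R + (v \in p.1)%:R * (u \in p.2)%:R)
        <= \sum_(q <- G | [set u; v] \in cov q.1) q.2,
    forall v, (v \in p.1)%:R <= \sum_(q <- G | v \in q.1) q.2 &
    coverage_size G = 1 + m%:R :> R].
  have [|pN] := boolP (p \in setX (indep M) (indep M)); last by exists [::].
  rewrite inE => /andP[I_M J_M].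
  have [G GP] := pair_coverage R cmin s_lt I_M J_M (card_le _ I_M).
  by exists G => _.
pose w (p : {set 'I_n} * {set 'I_n}) : R := l p.1 * l p.2.
have w_ge0 p : p \in setX (indep M) (indep M) -> 0 <= w p.
  by rewrite inE => /andP[I_M J_M]; rewrite mulr_ge0 ?l_ge0.
(* The coverages of the pairs are averaged with the product weights [w]. *)
pose Q := [seq (q.1, w p * q.2) | p <- enum (setX (indep M) (indep M)), q <- G p].
have sumQ (P : pred {set 'I_n}) : \sum_(q <- Q | P q.1) q.2 =
    \sum_(p in setX (indep M) (indep M)) w p * \sum_(q <- G p | P q.1) q.2.
  rewrite big_mkcond big_allpairs_dep /= big_enum /=.
  apply: eq_bigr => p _; rewrite [in RHS]big_mkcond mulr_sumr.
  by apply: eq_bigr => q _; case: ifP; rewrite ?mulr0.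
(* The first marginal of [w] is [l], because [l] sums to 1. *)
have sum_w (f : {set 'I_n} -> R) :
    \sum_(p in setX (indep M) (indep M)) w p * f p.1 = \sum_(I in indep M) l I * f I.
  transitivity (\sum_(I in indep M) \sum_(J in indep M) l I * l J * f I).
    by rewrite pair_big /=; apply: eq_bigl => -[I J]; rewrite inE.
  apply: eq_bigr => I _.
  by under eq_bigr do rewrite mulrAC; rewrite -mulr_sumr l_sum mulr1.
exists Q; split; first split.
- move=> _ /allpairsPdep[p [q [pE qG ->]]] /=; rewrite mem_enum in pE.
  have [/(_ q qG)[q_M q_ge0] _ _ _] := Gspec p pE.
  by split=> //; rewrite mulr_ge0 ?w_ge0.
- move=> u v uv; rewrite Cov_convex_combination (sumQ (fun K => [set u; v] \in cov K)).
  apply: ler_sum => p pE; have [_ /(_ u v uv) Gcov _ _] := Gspec p pE.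
  by rewrite ler_wpM2l ?w_ge0.
- move=> v; rewrite (sumQ (fun K => v \in K)) summxE.
  under eq_bigr do rewrite !mxE; rewrite -(sum_w (fun I => (v \in I)%:R)).
  apply: ler_sum => p pE; have [_ _ /(_ v) Gv _] := Gspec p pE.
  by rewrite ler_wpM2l ?w_ge0.
have -> : coverage_size Q = 1 + m%:R.
  rewrite /coverage_size (sumQ xpredT).
  under eq_bigr => p pE.
    have [_ _ _] := Gspec p pE; rewrite /coverage_size => ->; over.
  by rewrite (sum_w (fun=> 1 + m%:R)) -mulr_suml l_sum mul1r.
have c2_gt0 : 0 < c%:R - 2 :> R by rewrite subr_gt0 ltr_nat.
(* Here [m.-1] is [r %/ s] and [c - 2 <= s * 2]. The size is [1 + m], that is, 2 plus this
   quotient. *)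
have m_le : (m.-1 * (c - 2) <= 2 * r)%N.
  apply: (@leq_trans (m.-1 * (s * 2))); first by rewrite leq_mul2l; lia.
  by rewrite mulnA [leqRHS]mulnC leq_mul2r leq_trunc_div orbT.
have : m.-1%:R <= 2 * r%:R / (c%:R - 2) :> R.
  rewrite ler_pdivlMr // -natrB; last by lia.
  by rewrite -!natrM ler_nat.
by rewrite /m -natr1 /=; lra.
Qed.
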